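(* Let $f_{a,c}(z)=a\,\mathcal{B}_{d,k}(z)+c$. With finitely many exceptions $(d,k)$ (where $d\ge 3$, $1\le k\le d-2$), there exists a prime number $p$ such that for all $\alpha,\beta\in\overline{\mathbb{Q}}$: if $f_{\alpha,\beta}(z)$ is post-critically finite with periodic critical points, then $$v_p(\alpha)=0\quad\text{and}\quad v_p(\beta)\ge 0 .$$
   Context: For integers $d\ge 3$ and $1\le k\le d-2$, the normalized (single-cycle) Belyi polynomial is $$\mathcal{B}_{d,k}(z)=\sum_{i=0}^{k}\frac{(-1)^{k-i}}{(k-i)!\,i!}\Big(\prod_{0\le j\le k,\ j\ne i}(d-j)\Big)z^{d-i}.$$ For $a\neq 0$ the affine critical points of $f_{a,c}$ are exactly $0$ and $1$; ''post-critically finite with periodic critical points'' means that both $0$ and $1$ are periodic under iteration of $f_{\alpha,\beta}$. Here $v_p$ is the normalized $p$-adic valuation; for algebraic $\alpha,\beta$ the assertions $v_p(\alpha)=0$ and $v_p(\beta)\geq 0$ mean that $v_{\mathfrak p}(\alpha)=0$ and $v_{\mathfrak p}(\beta)\ge 0$ for the valuation $v_{\mathfrak p}$ of every prime $\mathfrak p$ of the number field $\mathbb{Q}(\alpha,\beta)$ lying above $p$. *)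

(* Defs.v *)
(* The algebraic closure of Q is algC. *)
From HB Require Import structures.
From mathcomp Require Import all_boot all_order all_algebra all_field.

Set Implicit Arguments.
Unset Strict Implicit.
Unset Printing Implicit Defensive.

Import Order.TTheory GRing.Theory Num.Theory.
Local Open Scope ring_scope.

Definition belyi (d k : nat) : {poly algC} :=
  \sum_(i < k.+1)
    ((-1) ^+ (k - i) / ((k - i)`! * i`!)%:R
       * \prod_(j < k.+1 | j != i) (d%:R - j%:R)) *: 'X^(d - i).

Definition belyi_family (d k : nat) (a c : algC) : {poly algC} :=
  a *: belyi d k + c%:P.

Definition periodic (f : {poly algC}) (x : algC) : Prop :=
  exists2 n : nat, (0 < n)%N & iter n (fun z => f.[z]) x = x.

(* For a != 0 the affine critical points of belyi_family d k a c are 0 and 1.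
   For a = 0 the map is constant and 0, 1 cannot both be periodic. *)
Definition pcf_periodic (f : {poly algC}) : Prop :=
  periodic f 0 /\ periodic f 1.

(* Q(a, b), the smallest subfield of algC containing a and b. *)
Definition Qadj2 (a b : algC) (x : algC) : Prop :=
  forall S : {pred algC}, divring_closed S -> a \in S -> b \in S -> x \in S.

Definition ring_of_integers (K : algC -> Prop) (x : algC) : Prop :=
  K x /\ x \in Aint.

Definition int_ideal (O I : algC -> Prop) : Prop :=
  [/\ forall x, I x -> O x,
      I 0,
      forall x y, I x -> I y -> I (x + y)
    & forall x y, O x -> I y -> I (x * y)].

Definition int_prime_ideal (O P : algC -> Prop) : Prop :=
  [/\ int_ideal O P,
      ~ P 1
    & forall x y, O x -> O y -> P (x * y) -> P x \/ P y].

Definition prime_ideal_above (K : algC -> Prop) (p : nat)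
    (P : algC -> Prop) : Prop :=
  int_prime_ideal (ring_of_integers K) P /\ P p%:R.

(* Product ideals consist of finite sums of products, and I ^ 0 = O. *)
Fixpoint ideal_exp (O I : algC -> Prop) (n : nat) : algC -> Prop :=
  match n with
  | 0 => O
  | m.+1 => fun x => exists2 s : seq (algC * algC),
      (forall u, u \in s -> I u.1 /\ ideal_exp O I m u.2)
      & x = \sum_(u <- s) u.1 * u.2
  end.

(* For x in O, the P-adic order of x is n; never satisfied by x = 0. *)
Definition ideal_ord (O P : algC -> Prop) (x : algC) (n : nat) : Prop :=
  ideal_exp O P n x /\ ~ ideal_exp O P n.+1 x.

(* [adic_val K P x m] reads "v_P(x) = m", where P is a nonzero prime of the
   number field K: every x in K is a quotient y / z of integers of K, and
   v_P(x) is the difference of the P-adic orders of y and z. Since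
   v_P(0) = +oo, it holds for no m : int when x = 0. *)
Definition adic_val (K P : algC -> Prop) (x : algC) (m : int) : Prop :=
  exists (y z : algC) (i j : nat),
    [/\ x = y / z,
        ideal_ord (ring_of_integers K) P y i,
        ideal_ord (ring_of_integers K) P z j
      & m = i%:Z - j%:Z].

Definition adic_val_ge0 (K P : algC -> Prop) (x : algC) : Prop :=
  x = 0 \/ exists2 m : int, adic_val K P x m & 0 <= m.

(* Main.v *)
Require Import Defs.
From HB Require Import structures.
From mathcomp Require Import all_boot all_order all_algebra all_field.
From mathcomp Require Import boolp classical_sets.
From mathcomp Require Import ring.

Set Implicit Arguments.
Unset Strict Implicit.
Unset Printing Implicit Defensive.

Import Order.TTheory GRing.Theory Num.Theory.
Local Open Scope ring_scope.

(** Write B for the Belyi polynomial and f = a B + c, and suppose that 0 and 1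
are periodic under f.  Every prime p that does not divide d! works, because
a, 1/a and c are integral over Z[1/d!].

By the valuative criterion it suffices that a, 1/a and c lie in every valuation
ring V of the algebraic numbers that contains 1/d!.  Over such a V the
polynomial B has coefficients in V and a unit leading coefficient, it fixes 0
and 1, and it has degree d >= 2 (lemmas [belyi_over], [lead_belyi_inv],
[belyi_horner0], [belyi_horner1]).  The dynamics is then settled by two
estimates ([valring_periodic]), in which |.| is the valuation written
multiplicatively and r = max(1, |c|).
- If |a| r^(d-1) > 1, then every z with |z| > 1 and |z| >= r escapes, since
  |f(z)| = |a z^d| > |z|; and c = f(0) or a + c = f(1) is such a z.
- If |a| r^(d-1) <= 1, then f preserves the disc |z| <= r and is 1-Lipschitz
  on it.  Let N > 0 be a common period of 0 and 1.  Then
  1 = |f^N(1) - f^N(0)| <= |f(1) - f(0)| = |a|, which together with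
  |a| r^(d-1) <= 1 forces r = 1 and |a| = 1.

The valuation rings come from Chevalley's theorem ([valring_dominating]): a
subring R that is maximal among those in which a given set S generates a proper
ideal is a valuation ring, and S lies in its maximal ideal.  With R = Z[1/m, 1/x]
and S = {1/x} this yields the valuative criterion ([Aint_valrings]).

Let P be a prime of K = Q(a, c) above p.  Multiplying by powers of d!, which lie
outside P, turns a, 1/a and c into algebraic integers, so a is a quotient of two
integers outside P, and c is a quotient of an integer by one outside P.  For c
to have an order at P, a nonzero integer y of K must leave some power of P
([ideal_ord_exists]).  This is seen in a valuation ring dominating the integers
of K at P: the elements of P have degree at most e = [K : Q], so their e-th
powers are divisible by p, and the e-th powers of elements of P^n are divisible
by p^n; but y divides a nonzero rational integer, which is divisible by finitely
many powers of p only. *)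

(** * Valuation rings of a field *)

Record valring (F : fieldType) := Valring {
  valring_pred :> {pred F};
  valring_subring : GRing.subring_closed valring_pred;
  valring_total : forall x, (x \in valring_pred) || (x^-1 \in valring_pred) }.

HB.instance Definition _ (F : fieldType) (V : valring F) :=
  GRing.isSubringClosed.Build F (valring_pred V) (valring_subring V).

(** The disjunct x == 0 is there because 0^-1 = 0 lies in V. *)
Definition valring_max (F : fieldType) (V : valring F) : {pred F} :=
  [pred x | (x \in V) && ((x == 0) || (x^-1 \notin V))].

Section ValuationRings.

Variables (F : fieldType) (V : valring F).

Lemma valring_invP x : x \notin V -> x^-1 \in V.
Proof. by move=> /negbTE xV; have := valring_total V x; rewrite xV. Qed.

Lemma valring_max_sub x : x \in valring_max V -> x \in V.
Proof. by case/andP. Qed.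

Lemma valring_max_neq1 : 1 \notin valring_max V.
Proof. by rewrite inE oner_eq0 invr1 rpred1. Qed.

Lemma valring_maxMr x y : x \in valring_max V -> y \in V ->
  x * y \in valring_max V.
Proof.
move=> /andP[xV xm] yV; rewrite inE rpredM //=.
case: eqVneq xm => [->|x0 /= xm]; first by rewrite mul0r eqxx.
case: (eqVneq y 0) => [->|y0]; first by rewrite mulr0 eqxx.
apply/orP; right; apply: contra xm => xyV.
have -> : x^-1 = y * (x * y)^-1 by field; rewrite x0 y0.
by rewrite rpredM.
Qed.

(** V is local: either x / (u + x) or its inverse lies in V, and the latter
would make x invertible. *)
Lemma valring_unit_addr u x : u \in V -> u^-1 \in V -> u != 0 ->
  x \in valring_max V -> (u + x)^-1 \in V.
Proof.
move=> uV uiV u0 /andP[xV xm].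
case: eqVneq xm => [->|x0 /= xm]; first by rewrite addr0.
case: (eqVneq (u + x) 0) => [->|w0]; first by rewrite invr0 rpred0.
have /orP[/= h|/= h] := valring_total V (x / (u + x)).
  have -> : (u + x)^-1 = u^-1 * (1 - x / (u + x)) by field; rewrite w0.
  by rewrite rpredM // rpredB // rpred1.
case/negP: xm.
have -> : x^-1 = u^-1 * ((x / (u + x))^-1 - 1) by field; rewrite w0 u0 x0.
by rewrite rpredM // rpredB // rpred1.
Qed.

Lemma valring_root n x : x ^+ n \in V -> (0 < n)%N -> x \in V.
Proof.
move=> xnV n0; apply: contraT => xV.
have x0 : x != 0 by apply: contraNneq xV => ->; rewrite rpred0.
have xiV := valring_invP xV.
case/negP: xV; have -> : x = x ^+ n * x^-1 ^+ n.-1.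
  by rewrite -{1}(prednK n0) exprS exprVn mulfK // expf_neq0.
by rewrite rpredM // rpredX.
Qed.

End ValuationRings.

(** * Existence of valuation rings *)

Definition subring (F : fieldType) (A : set F) :=
  [/\ A 1, forall x y, A x -> A y -> A (x - y)
    & forall x y, A x -> A y -> A (x * y)].

(** The ideal of A generated by S, when S is contained in A.  A membership
derivation uses finitely many elements of A, so membership over the union of a
chain descends to a member of the chain. *)
Inductive ideal_gen (F : fieldType) (S A : set F) : F -> Prop :=
| IdealGen0 : ideal_gen S A 0
| IdealGenD s a x : S s -> A a -> ideal_gen S A x ->
    ideal_gen S A (s * a + x).

Definition adjoin (F : fieldType) (A : set F) (u : F) : set F :=
  fun y => exists2 q : {poly F}, (forall i, A q`_i) & y = q.[u].

Section Subrings.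

Variables (F : fieldType) (S A : set F).
Hypothesis Aring : subring A.

Lemma subring0 : A 0.
Proof. by case: Aring => A1 AB _; rewrite -(subrr 1); apply: AB. Qed.

Lemma subringD x y : A x -> A y -> A (x + y).
Proof.
have A0 := subring0; case: (Aring) => _ AB _ Ax Ay.
by rewrite -[y]opprK -(sub0r y); apply: (AB) => //; apply: AB.
Qed.

Lemma subring_sum n (a : 'I_n -> F) : (forall i, A (a i)) ->
  A (\sum_(i < n) a i).
Proof.
by move=> Aa; elim/big_ind: _ => //; [exact: subring0 | exact: subringD].
Qed.

Lemma ideal_gen_add x y :
  ideal_gen S A x -> ideal_gen S A y -> ideal_gen S A (x + y).
Proof.
elim=> [|s a z Ss Aa _ IH] Iy; first by rewrite add0r.
by rewrite -addrA; apply: IdealGenD => //; apply: IH.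
Qed.

Lemma ideal_gen_mul x a : ideal_gen S A x -> A a -> ideal_gen S A (x * a).
Proof.
case: (Aring) => _ _ AM Ix Aa; elim: Ix => [|s b z Ss Ab _ IH].
  by rewrite mul0r; exact: IdealGen0.
by rewrite mulrDl -mulrA; apply: IdealGenD => //; apply: AM.
Qed.

Lemma ideal_gen_sum n (a : 'I_n -> F) : (forall i, ideal_gen S A (a i)) ->
  ideal_gen S A (\sum_(i < n) a i).
Proof.
by move=> Ia; elim/big_ind: _ => //; [exact: IdealGen0 | exact: ideal_gen_add].
Qed.

Hypothesis SA : forall s, S s -> A s.

Lemma ideal_gen_sub x : ideal_gen S A x -> A x.
Proof.
elim=> [|s a z Ss Aa _ Az]; first exact: subring0.
by apply: subringD => //; case: Aring => _ _; apply=> //; exact: SA.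
Qed.

Lemma subring_exp x n : A x -> A (x ^+ n).
Proof.
case: Aring => A1 _ AM Ax; elim: n => [|n IH]; rewrite ?expr0 // exprS.
exact: AM.
Qed.

Lemma adjoin_subring u : subring (adjoin A u).
Proof.
case: (Aring) => A1 AB AM; split.
- exists 1 => [i|]; last by rewrite hornerC.
  by rewrite coef1; case: eqP => // _; exact: subring0.
- move=> _ _ [p Ap ->] [q Aq ->]; exists (p - q) => [i|].
    by rewrite coefB; apply: AB.
  by rewrite !hornerE.
- move=> _ _ [p Ap ->] [q Aq ->]; exists (p * q) => [i|].
    by rewrite coefM; apply: subring_sum => j; apply: AM.
  by rewrite hornerM.
Qed.

Lemma sub_adjoin u x : A x -> adjoin A u x.
Proof.
move=> Ax; exists x%:P => [i|]; last by rewrite hornerC.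
by rewrite coefC; case: eqP => // _; exact: subring0.
Qed.

Lemma mem_adjoin u : adjoin A u u.
Proof.
exists 'X => [i|]; last by rewrite hornerX.
by rewrite coefX; case: eqP => _; [case: Aring | exact: subring0].
Qed.

(** A relation over A[u] is a polynomial relation for u whose coefficients lie
in the ideal that S generates in A itself. *)
Lemma ideal_gen_adjoin u x : ideal_gen S (adjoin A u) x ->
  exists2 q : {poly F}, (forall i, ideal_gen S A q`_i) & x = q.[u].
Proof.
elim=> [|s _ _ Ss [p Ap ->] _ [q Iq ->]].
  by exists 0 => [i|]; rewrite ?coef0 ?horner0 //; exact: IdealGen0.
exists (s *: p + q) => [i|]; last by rewrite !hornerE.
by rewrite coefD coefZ; apply: IdealGenD.
Qed.

End Subrings.

Section Chevalley.

Variables (F : fieldType) (R S : set F).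
Hypotheses (Rring : subring R) (SR : forall s, S s -> R s).
Hypothesis S1 : ~ ideal_gen S R 1.

Let admissible (A : set F) :=
  [/\ subring A, forall x, R x -> A x & ~ ideal_gen S A 1].

(** Zorn's lemma applies because 1 would already be in the ideal generated
over some member of the chain. *)
Lemma admissible_maximal :
  exists2 A : set F, admissible A &
  forall B, admissible B -> (forall x, A x -> B x) -> forall x, B x -> A x.
Proof.
(* the empty set is allowed because the union of the empty chain is empty *)
pose P := [set A : set F | A = set0 \/ admissible A]%classic.
have [G GP tot|A [PA maxA]] := @Zorn_bigcup F P.
  set U := (\bigcup_(X in G) X)%classic.
  have [[A0 GA0 adm0]|no] :=
      pselect (exists2 A, G A & admissible A); last first.
    left; rewrite -subset0 => x [A GA Ax]; case: (GP _ GA) => [A0|adm].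
      by rewrite A0 in Ax.
    by case: no; exists A.
  have common x y : U x -> U y -> exists2 A, G A /\ admissible A & A x /\ A y.
    move=> [A GA Ax] [B GB By].
    have admA : admissible A by case: (GP _ GA) => // A0'; rewrite A0' in Ax.
    have admB : admissible B by case: (GP _ GB) => // B0'; rewrite B0' in By.
    case: (tot _ _ GA GB) => sub; first by exists B; split=> //; exact: sub.
    by exists A; split=> //; exact: sub.
  have Usub x : A0 x -> U x by move=> ?; exists A0.
  right; split.
  - split.
    + by apply: Usub; case: adm0 => [[]].
    + move=> x y Ux Uy; case: (common _ _ Ux Uy) => A [GA [[_ AB _] _ _]].
      by case=> Ax Ay; exists A => //; apply: AB.
    + move=> x y Ux Uy; case: (common _ _ Ux Uy) => A [GA [[_ _ AM] _ _]].
      by case=> Ax Ay; exists A => //; apply: AM.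
  - by move=> x Rx; apply: Usub; case: adm0 => _ + _; apply.
  - move=> I1.
    suff [A [GA admA IA]] : exists A, [/\ G A, admissible A & ideal_gen S A 1].
      by case: admA.
    elim: I1 => [|s a x Ss [B GB Ba] _ [A [GA admA IA]]].
      by exists A0; split=> //; exact: IdealGen0.
    have admB : admissible B by case: (GP _ GB) => // B0'; rewrite B0' in Ba.
    have mono (C D : set F) z : (forall t, C t -> D t) ->
        ideal_gen S C z -> ideal_gen S D z.
      move=> CD; elim=> [|s' a' z' Ss' Ca' _ IH]; first exact: IdealGen0.
      by apply: IdealGenD => //; exact: CD.
    case: (tot _ _ GA GB) => sub; [exists B | exists A]; split=> //.
      by apply: IdealGenD => //; exact: mono IA.
    by apply: IdealGenD => //; exact: sub.
have Rmax B : admissible B -> ~ (A `<` B)%classic.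
  by move=> admB ltAB; apply: (maxA B) => //; right.
have admA : admissible A.
  case: PA => // A0; case: (Rmax R); first by split.
  rewrite A0; split=> // R0; apply: (R0 1).
  by case: Rring.
exists A => // B admB AB x Bx; apply: contrapT => Ax.
by apply: (Rmax B) => //; split=> // BA; apply: Ax; apply: BA.
Qed.

(** Chevalley's theorem.  Let A be maximal.  If u is not in A, then S generates
the unit ideal of A[u], which is a polynomial relation for u with value 1.  If
1/u is not in A either, there is one for 1/u too; the one of smaller degree
expresses the top power of u, or of 1/u, by lower powers and so shortens the
other one, and this cannot go on forever. *)
Lemma valring_dominating : exists V : valring F,
  (forall x, R x -> x \in V) /\ (forall s, S s -> s \in valring_max V).
Proof.
have [A [Aring RA A1] maxA] := admissible_maximal.
have SA s : S s -> A s by move=> /SR/RA.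
have relation u : ~ A u ->
    exists2 q : {poly F}, (forall i, ideal_gen S A q`_i) & q.[u] = 1.
  move=> Au; have [|q Iq e] := @ideal_gen_adjoin F S A u 1; last by exists q.
  apply: contrapT => no; apply: Au; apply: (maxA (adjoin A u)).
  - split=> //; first exact: adjoin_subring.
    by move=> x /RA Ax; apply: sub_adjoin.
  - by move=> x; apply: sub_adjoin.
  - exact: mem_adjoin.
(* A is local along S: a relation for 1/(1-b), multiplied by a power of 1-b,
   would put 1 into the ideal *)
have unit b : ideal_gen S A b -> 1 - b != 0 /\ A (1 - b)^-1.
  move=> Ib; have b0 : 1 - b != 0.
    by apply/eqP => /subr0_eq e; apply: A1; rewrite e.
  split=> //; apply: contrapT => /relation[q Iq q1]; apply: A1.
  have [pw Ipw e] : exists2 t, ideal_gen S A t & (1 - b) ^+ size q = 1 - t.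
    elim: (size q) => [|n [t It e]].
      by exists 0; [exact: IdealGen0 | rewrite expr0 subr0].
    exists (b + t * (1 - b)); last by rewrite exprS e; ring.
    apply: ideal_gen_add => //; apply: ideal_gen_mul => //.
    by case: (Aring) => ? AB _; apply: AB => //; apply: ideal_gen_sub Ib.
  have -> : 1 = (1 - b) ^+ size q * q.[(1 - b)^-1] + pw by rewrite q1 e; ring.
  apply: ideal_gen_add => //.
  rewrite horner_coef mulr_sumr; apply: ideal_gen_sum => i.
  rewrite mulrC -mulrA; apply: ideal_gen_mul => //.
  rewrite exprVn mulrC -exprB ?unitfE //; last exact: ltnW.
  apply: subring_exp => //.
  by case: (Aring) => ? AB _; apply: AB => //; apply: ideal_gen_sub Ib.
have no_pair N : forall u (q r : {poly F}), u != 0 ->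
    (size q + size r <= N)%N ->
    (forall i, ideal_gen S A q`_i) -> (forall i, ideal_gen S A r`_i) ->
    q.[u] = 1 -> r.[u^-1] = 1 -> False.
  elim: N => [|N IH] u q r u0 sz Iq Ir qu ru.
    move: sz; rewrite leqn0 addn_eq0 size_poly_eq0 => /andP[/eqP q0 _].
    by have := oner_neq0 F; rewrite -qu q0 horner0 eqxx.
  wlog le : u q r u0 sz Iq Ir qu ru / (size r <= size q)%N.
    move=> wl; case: (leqP (size r) (size q)) => [|/ltnW] le.
      exact: (wl u q r).
    by apply: (wl u^-1 r q); rewrite ?invr_eq0 ?invrK // addnC.
  case: (posnP (size q)) => [q0|q_gt0].
    by have := oner_neq0 F; rewrite -qu horner_coef q0 big_ord0 eqxx.
  move: (prednK q_gt0); set n := (size q).-1 => sq.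
  have [b0 Ab0] := unit _ (Ir 0%N).
  (* solve the relation for 1/u for the top power of u *)
  have top : u ^+ n = \sum_(i < n) (1 - r`_0)^-1 * r`_(n - i) * u ^+ i.
    have e : u ^+ n = \sum_(i < n.+1) r`_(n - i) * u ^+ i.
      have ler : (size r <= n.+1)%N by rewrite sq.
      rewrite -[LHS]mul1r -ru (horner_coef_wide _ ler).
      rewrite mulr_suml (reindex_inj rev_ord_inj) /=.
      apply: eq_bigr => i _; rewrite subSS -mulrA; congr (_ * _).
      rewrite exprVn mulrC -exprB ?unitfE ?leq_subr //.
      by rewrite subKn // -ltnS.
    move: e; rewrite big_ord_recr /= subnn => e.
    transitivity ((1 - r`_0)^-1 * \sum_(i < n) r`_(n - i) * u ^+ i).
      by apply: (mulfI b0); rewrite mulVKf // mulrBl mul1r {1}e addrK.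
    by rewrite mulr_sumr; apply: eq_bigr => i _; rewrite mulrA.
  pose q' := \poly_(i < n) (q`_i + q`_n * ((1 - r`_0)^-1 * r`_(n - i))).
  apply: (IH u q' r) => //.
  - rewrite -ltnS; apply: leq_trans sz; rewrite -sq addSn ltnS leq_add2r.
    exact: size_poly.
  - move=> i; rewrite coef_poly; case: ifP => _; last exact: IdealGen0.
    apply: ideal_gen_add => //; apply: ideal_gen_mul => //.
    by case: (Aring) => _ _; apply=> //; apply: ideal_gen_sub (Ir _).
  have leq : (size q <= n.+1)%N by rewrite sq.
  rewrite -[RHS]qu horner_poly (horner_coef_wide _ leq).
  rewrite big_ord_recr /= top mulr_sumr -big_split /=.
  by apply: eq_bigr => i _; rewrite mulrDl !mulrA.
have Aclosed : GRing.subring_closed [pred x | `[< A x >]].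
  case: (Aring) => ? AB AM; split; first exact/asboolP.
    by move=> x y /asboolP Ax /asboolP Ay; apply/asboolP/AB.
  by move=> x y /asboolP Ax /asboolP Ay; apply/asboolP/AM.
have Atotal x :
    (x \in [pred x | `[< A x >]]) || (x^-1 \in [pred x | `[< A x >]]).
  apply/orP.
  have [Ax|Ax] := pselect (A x); first by left; apply/asboolP.
  have [Axi|Axi] := pselect (A x^-1); first by right; apply/asboolP.
  have x0 : x != 0 by apply/eqP => e; apply: Ax; rewrite e; apply: subring0.
  have [q Iq q1] := relation _ Ax; have [r Ir r1] := relation _ Axi.
  by case: (no_pair _ x q r x0 (leqnn _)).
exists (Valring Aclosed Atotal); split=> [x /RA Ax | s Ss]; first exact/asboolP.
rewrite !inE; apply/andP; split; first exact/asboolP/SA.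
case: eqVneq => //= s0; apply/asboolP => Asi; apply: A1.
rewrite -(mulfV s0) -[_ / _]addr0; apply: IdealGenD => //; exact: IdealGen0.
Qed.

End Chevalley.

(** * Integrality and coprime integers *)

Lemma monic_relation_Aint (n : nat) (e : nat -> algC) x :
  (forall j, e j \in Num.int) -> x ^+ n = \sum_(j < n) e j * x ^+ j ->
  x \in Aint.
Proof.
move=> eZ xn; apply: (@root_monic_Aint ('X^n - \poly_(j < n) e j)).
- by rewrite rootE hornerD hornerN horner_poly hornerXn xn subrr.
- rewrite monicE lead_coefDl ?lead_coefXn //.
  by rewrite size_polyN size_polyXn ltnS size_poly.
- apply/polyOverP=> j; rewrite coefB coefXn coef_poly.
  by apply: rpredB; [exact: rpred_nat | case: ifP; rewrite ?rpred0].
Qed.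

(** The valuative criterion for integrality over Z[1/m].  In R = Z[1/m, 1/x],
either 1/x generates a proper ideal, and then some valuation ring contains R but
not x, or x itself lies in R, which is an equation of integral dependence. *)
Lemma Aint_valrings (m : nat) (x : algC) : (0 < m)%N ->
  (forall V : valring algC, m%:R^-1 \in V -> x \in V) ->
  exists N, m%:R ^+ N * x \in Aint.
Proof.
move=> m_gt0 xV; have m0 : m%:R != 0 :> algC by rewrite pnatr_eq0 -lt0n.
have [->|x0] := eqVneq x 0; first by exists 0%N; rewrite mulr0 Aint0.
pose R : set algC := fun r => exists N (q : {poly int}),
  m%:R ^+ N * r = (map_poly intr q).[x^-1].
have Rring : subring R.
  split.
  - by exists 0%N, 1; rewrite expr0 rmorph1 hornerC mulr1.
  - move=> r s [N [q eq]] [M [p ep]].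
    exists (N + M)%N, (q *+ (m ^ M)%N - p *+ (m ^ N)%N).
    rewrite rmorphB !rmorphMn hornerD hornerN !hornerMn -eq -ep.
    rewrite -(mulr_natl _ (m ^ M)%N) -(mulr_natl _ (m ^ N)%N) !natrX exprD.
    by ring.
  - move=> r s [N [q eq]] [M [p ep]]; exists (N + M)%N, (q * p).
    by rewrite rmorphM hornerM -eq -ep exprD; ring.
have Rint (q : {poly int}) : R (map_poly intr q).[x^-1].
  by exists 0%N, q; rewrite expr0 mul1r.
pose S : set algC := fun s => s = x^-1.
have SR s : S s -> R s.
  by move=> ->; have := Rint 'X; rewrite map_polyX hornerX.
have [I1|I1] := pselect (ideal_gen S R 1); last first.
  have [V [RV SV]] := valring_dominating Rring SR I1.
  have := SV x^-1 erefl; rewrite !inE invr_eq0 (negPf x0) invrK /=.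
  rewrite xV ?andbF //; apply: RV; exists 1%N, 1.
  by rewrite expr1 mulfV // rmorph1 hornerC.
have [r [N [q eq]] e] : exists2 r, R r & 1 = x^-1 * r.
  elim: I1 => [|s a y -> Ra _ [r Rr ->]].
    by exists 0; rewrite ?mulr0 //; exact: subring0.
  by exists (a + r); [exact: subringD | rewrite mulrDr].
have {e} er : r = x by apply: (mulfI (invr_neq0 x0)); rewrite -e mulVf.
rewrite {}er in eq; exists N; set X := _ * x.
have [n n_ge] : exists n, (size (map_poly intr q : {poly algC}) <= n.+1)%N.
  by exists (size (map_poly intr q : {poly algC})).
(* clear denominators in m^N x = q(1/x) by multiplying with (m^N)^n x^n *)
apply: (@monic_relation_Aint n.+1
         (fun j => (q`_(n - j))%:~R * m%:R ^+ (N * (n - j)))) => [j|].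
  by rewrite rpredM ?rpredX ?rpred_nat // intr_int.
rewrite exprS {1}/X eq (horner_coef_wide _ n_ge) mulr_suml.
rewrite (reindex_inj rev_ord_inj) /=.
apply: eq_bigr => j _; rewrite subSS coef_map /= -!mulrA; congr (_ * _).
have jn : (j <= n)%N by rewrite -ltnS.
have -> : X ^+ n = X ^+ (n - j) * X ^+ j by rewrite -exprD subnK.
rewrite mulrA; congr (_ * _).
by rewrite exprM /X exprMn exprVn mulrCA mulVf ?mulr1 // expf_neq0.
Qed.

Lemma intr_coprimez (c p : int) : coprimez c p ->
  exists u v : int, u%:~R * c%:~R + v%:~R * p%:~R = 1 :> algC.
Proof.
move=> /eqP cp; have [u [v e]] := Bezoutz c p; exists u, v.
by rewrite -!intrM -intrD e cp.
Qed.

Lemma valring_int (V : valring algC) (c : int) : c%:~R \in V.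
Proof. exact: rpred_int. Qed.

(** In a Bezout relation u c + v p = 1 the term v p is in the maximal ideal, so
u c is a unit. *)
Lemma valring_coprime_inv (V : valring algC) (c p : int) :
  p%:~R \in valring_max V -> coprimez c p -> c%:~R^-1 \in V.
Proof.
move=> pV /intr_coprimez[u [v e]].
have c0 : c%:~R != 0 :> algC.
  apply/eqP => c0; move: e; rewrite c0 mulr0 add0r => e.
  have := valring_maxMr pV (valring_int V v).
  by rewrite mulrC e (negPf (valring_max_neq1 V)).
have uc : u%:~R * c%:~R = 1 + p%:~R * (- v%:~R) :> algC.
  by rewrite (canRL (addrK _) e) mulrN [v%:~R * _]mulrC.
have : (u%:~R * c%:~R)^-1 \in V.
  rewrite uc valring_unit_addr ?invr1 ?rpred1 ?oner_neq0 //.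
  by apply: valring_maxMr => //; rewrite rpredN valring_int.
have u0 : u%:~R != 0 :> algC.
  apply/eqP => u0; have := valring_max_neq1 V; case/negP.
  have -> : 1 = p%:~R * v%:~R :> algC.
    by move: e; rewrite u0 mul0r add0r mulrC => ->.
  exact: valring_maxMr (valring_int V v).
rewrite invfM => h; have -> : c%:~R^-1 = u%:~R * (u%:~R^-1 / c%:~R) :> algC.
  by rewrite mulVKf.
by rewrite rpredM // valring_int.
Qed.

(** * Periodic critical points over a valuation ring *)

Section Dynamics.

Variables (F : fieldType) (V : valring F).

Lemma horner_lipschitz (g : {poly F}) u v : g \is a polyOver V ->
  u \in V -> v \in V -> exists2 w, w \in V & g.[u] - g.[v] = (u - v) * w.
Proof.
move=> /polyOverP gV uV vV; rewrite !horner_coef -sumrB.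
exists (\sum_(i < size g)
    g`_i * \sum_(j < i) u ^+ (i.-1 - j) * v ^+ j).
  apply: rpred_sum => i _; rewrite rpredM //.
  by apply: rpred_sum => j _; rewrite rpredM ?rpredX.
rewrite mulr_sumr; apply: eq_bigr => i _.
by rewrite -mulrBr subrXX mulrCA.
Qed.

Lemma iter_lipschitz (h : F -> F) r :
  (forall x y, x / r \in V -> y / r \in V -> h x / r \in V /\
     exists2 w, w \in V & h x - h y = (x - y) * w) ->
  forall n x y, x / r \in V -> y / r \in V ->
     exists2 w, w \in V & iter n h x - iter n h y = (x - y) * w.
Proof.
move=> hV; elim=> [|n IH] x y xV yV; first by exists 1; rewrite ?rpred1 ?mulr1.
have [hx [w wV e]] := hV x y xV yV; have [hy _] := hV y y yV yV.
have [w' w'V e'] := IH _ _ hx hy; exists (w * w'); first exact: rpredM.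
by rewrite !iterSr e' e mulrA.
Qed.

(** If |h(x)| > |x| on a forward-invariant set P, then |h^n(z)| grows strictly
along the orbit of a point z of P. *)
Lemma iter_escape (h : F -> F) (P : F -> Prop) z :
  (forall x, P x -> [/\ x != 0, P (h x) & h x / x \notin V]) ->
  P z -> forall n, (0 < n)%N -> iter n h z <> z.
Proof.
move=> hP Pz n n_gt0 e; have z0 : z != 0 by case: (hP z Pz).
have [Pn] : P (iter n h z) /\ iter n h z / z \notin V; last first.
  by rewrite e mulfV // rpred1.
case: n n_gt0 {e} => // n _; elim: n => [|n [Pn IH]].
  by case: (hP z Pz).
rewrite iterS; move: (iter n.+1 h z) Pn IH => x Px IH.
have [x0 Phx hx] := hP _ Px; split=> //; apply: contra IH => hV.
have [hx0 _ _] := hP _ Phx.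
have -> : x / z = (h x / x)^-1 * (h x / z) by field; rewrite z0 x0 hx0.
by rewrite rpredM // valring_invP.
Qed.

Variables (B : {poly F}) (a c : F) (d : nat).
Hypotheses (BV : B \is a polyOver V) (Bsize : size B = d.+1).
Hypothesis d_gt1 : (1 < d)%N.
Hypotheses (lcBV : (lead_coef B)^-1 \in V) (B0 : B.[0] = 0) (B1 : B.[1] = 1).

Let f := a *: B + c%:P.

Let hornerf x : f.[x] = a * B.[x] + c.
Proof. by rewrite !hornerE. Qed.

Let B_coef0 : B`_0 = 0.
Proof. by rewrite -horner_coef0 B0. Qed.

(** For |z| > 1 the leading term dominates in B, so |f(z)| = |a z^d|; the
hypotheses on r, which say |a| r^(d-1) > 1, |c| <= |r| and |z| >= |r|, make this
larger than |z| and |c|. *)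
Lemma escape_step r z : a * r ^+ d.-1 \notin V -> c / r \in V -> r != 0 ->
  z \notin V -> r / z \in V ->
  [/\ z != 0, f.[z] \notin V, r / f.[z] \in V & f.[z] / z \notin V].
Proof.
move=> arV crV r0 zV rzV.
have z0 : z != 0 by apply: contraNneq zV => ->; rewrite rpred0.
have ziV := valring_invP zV.
have zim : z^-1 \in valring_max V by rewrite inE ziV invr_eq0 invrK zV orbT.
have b0 : lead_coef B != 0.
  by rewrite lead_coef_eq0 -size_poly_eq0 Bsize.
(* B(z) / z^d is the leading coefficient plus an element of the ideal *)
pose s := \sum_(i < d) B`_i * z^-1 ^+ (d - i.+1).
have sV : s \in V.
  by apply: rpred_sum => i _; rewrite rpredM ?rpredX // (polyOverP BV).
have bV : lead_coef B \in V by exact: (polyOverP BV).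
pose e := lead_coef B + z^-1 * s.
have Bz : B.[z] = z ^+ d * e.
  have szB : (size B <= d.+1)%N by rewrite Bsize.
  rewrite (horner_coef_wide _ szB) big_ord_recr /= addrC mulrDr.
  congr (_ + _); first by rewrite mulrC lead_coefE Bsize.
  rewrite mulrA mulr_sumr; apply: eq_bigr => i _.
  rewrite mulrCA; congr (_ * _).
  rewrite -mulrA -exprS -subSn // subSS exprVn.
  rewrite -exprB ?unitfE ?leq_subr //; first by rewrite subKn // ltnW.
have eiV : e^-1 \in V by rewrite valring_unit_addr // valring_maxMr.
have fzV : f.[z] / z \notin V.
  apply: contra arV => fzV.
  have azV : a * z ^+ d.-1 \in V.
    have e0 : e != 0.
      apply: contraNneq (valring_max_neq1 V) => e0.
      have -> : 1 = z^-1 * (- s / lead_coef B).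
        have h : z^-1 * s = - lead_coef B.
          by apply/eqP; rewrite -addr_eq0 addrC -/e e0.
        by rewrite mulrA mulrN h opprK mulfV.
      by rewrite valring_maxMr // rpredM // rpredN.
    have -> : a * z ^+ d.-1 = (f.[z] / z - (c / r) * (r / z)) * e^-1.
      rewrite hornerf Bz -{2}(prednK (ltnW d_gt1)) exprS.
      by field; rewrite e0 r0 z0.
    by rewrite rpredM // rpredB // rpredM.
  have -> : a * r ^+ d.-1 = (a * z ^+ d.-1) * (r / z) ^+ d.-1.
    by rewrite expr_div_n; field; rewrite expf_neq0.
  by rewrite rpredM // rpredX.
have zf := valring_invP fzV; rewrite invf_div in zf.
split=> //.
  apply: contra zV => fV.
  have [f0|f0] := eqVneq f.[z] 0; first by rewrite f0 mul0r rpred0 in fzV.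
  by have -> : z = z / f.[z] * f.[z] by [rewrite mulfVK]; rewrite rpredM.
by have -> : r / f.[z] = r / z * (z / f.[z]) by [rewrite mulrA mulfVK];
  rewrite rpredM.
Qed.

(** Escape excludes |a| r^(d-1) > 1; otherwise f is 1-Lipschitz on a disc that
contains both orbits, and 1 = |f^N(1) - f^N(0)| <= |f(1) - f(0)| = |a|. *)
Lemma valring_periodic n0 n1 : (0 < n0)%N -> (0 < n1)%N ->
  iter n0 (horner f) 0 = 0 -> iter n1 (horner f) 1 = 1 ->
  [/\ a \in V, a^-1 \in V & c \in V].
Proof.
move=> n0_gt0 n1_gt0 per0 per1.
have f0 : f.[0] = c by rewrite hornerf B0 mulr0 add0r.
have f1 : f.[1] = a + c by rewrite hornerf B1 mulr1.
have per_image n x : iter n (horner f) x = x ->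
    iter n (horner f) f.[x] = f.[x].
  by move=> e; rewrite -iterSr iterS e.
(* |r| = max(1, |c|) *)
pose r := if c \in V then 1 else c.
have r0 : r != 0.
  rewrite /r; case: ifPn => [_|cV]; first exact: oner_neq0.
  by apply: contraNneq cV => ->; rewrite rpred0.
have riV : r^-1 \in V.
  by rewrite /r; case: ifPn => [_|/valring_invP //]; rewrite invr1 rpred1.
have crV : c / r \in V.
  rewrite /r; case: ifPn => [cV|cV]; first by rewrite divr1.
  by rewrite mulfV ?rpred1 //; apply: contraNneq cV => ->; rewrite rpred0.
have arV : a * r ^+ d.-1 \in V.
  apply: contraT => arV.
  have esc z : z \notin V -> r / z \in V ->
      forall n, (0 < n)%N -> iter n (horner f) z <> z.
    move=> zV rzV; apply: (@iter_escape _ (fun z => z \notin V /\ r / z \in V)).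
      by move=> x [xV rxV]; case: (escape_step arV crV r0 xV rxV).
    by [].
  have [cV|cV] := boolP (c \in V).
    have r1 : r = 1 by rewrite /r cV.
    have aV : a + c \notin V.
      apply: contra arV => acV; rewrite r1 expr1n mulr1.
      by rewrite -[a](addrK c) rpredB.
    case: (esc (a + c) aV _ n1 n1_gt0); last by rewrite -f1 per_image.
    by rewrite r1 div1r valring_invP.
  case: (esc c cV _ n0 n0_gt0); last by rewrite -f0 per_image.
  by rewrite /r (negPf cV) mulfV ?rpred1 //; apply: contraNneq cV => ->;
    rewrite rpred0.
(* f in the coordinate u = z / r has coefficients in V *)
pose g := \poly_(i < d.+1) (f`_i * r ^+ i / r).
have gV : g \is a polyOver V.
  apply/polyOverP=> i; rewrite coef_poly.
  case: ltnP => [|_]; last exact: rpred0.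
  rewrite ltnS => i_le; rewrite coefD coefZ coefC.
  case: i i_le => [|i] i_lt /=.
    by rewrite B_coef0 mulr0 add0r expr0 mulr1.
  have -> : (a * B`_i.+1 + 0) * r ^+ i.+1 / r
      = (a * r ^+ d.-1) * B`_i.+1 * r^-1 ^+ (d.-1 - i).
    have i_le : (i <= d.-1)%N by rewrite -ltnS prednK // ltnW.
    rewrite -{1}(subnK i_le) exprD exprVn exprS.
    by field; rewrite r0 expf_neq0.
  by apply: rpredM (rpredX _ riV); apply: rpredM => //; apply/polyOverP.
have gE x : f.[x] / r = g.[x / r].
  have szf : (size f <= d.+1)%N.
    rewrite (leq_trans (size_polyD _ _)) // geq_max.
    rewrite (leq_trans (size_scale_leq _ _)) ?Bsize //=.
    by rewrite size_polyC; case: (c != 0).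
  rewrite horner_poly (horner_coef_wide _ szf) mulr_suml.
  apply: eq_bigr => i _; rewrite expr_div_n.
  by field; rewrite r0 expf_neq0.
have fV x y : x / r \in V -> y / r \in V -> f.[x] / r \in V /\
    exists2 w, w \in V & f.[x] - f.[y] = (x - y) * w.
  move=> xV yV; split; first by rewrite gE rpred_horner.
  have [w wV e] := horner_lipschitz gV xV yV; exists w => //.
  apply: (mulIf (invr_neq0 r0)).
  by rewrite mulrBl !gE e -mulrBl -!mulrA [w / r]mulrC.
(* compare the orbits of f(0) and f(1) up to a common period of 0 and 1 *)
have [v vV av] : exists2 v, v \in V & 1 = a * v.
  have N_gt0 : (0 < n1 * n0)%N by rewrite muln_gt0 n1_gt0.
  have fix0 : iter (n1 * n0) (horner f) 0 = 0 by rewrite iterM iter_fix.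
  have fix1 : iter (n1 * n0) (horner f) 1 = 1.
    by rewrite mulnC iterM iter_fix.
  have V0 : 0 / r \in V by rewrite mul0r rpred0.
  have V1 : 1 / r \in V by rewrite div1r.
  have [c_V _] := fV _ _ V0 V0; have [ac_V _] := fV _ _ V1 V1.
  have [v vV e] := iter_lipschitz fV (n1 * n0).-1 ac_V c_V.
  exists v => //; move: e; rewrite -!iterSr prednK // fix0 fix1 subr0 => ->.
  by rewrite f0 f1 addrK.
have a0 : a != 0.
  by apply/eqP=> a0; have := oner_neq0 F; rewrite av a0 mul0r eqxx.
have aiV : a^-1 \in V by rewrite -[a^-1]mulr1 av mulKf.
have rV : r \in V.
  apply: (@valring_root _ _ d.-1); last by rewrite -ltnS prednK // ltnW.
  by rewrite -(mulKf a0 (r ^+ d.-1)) rpredM.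
split=> //; last by rewrite -(divfK r0 c) rpredM.
have -> : a = (a * r ^+ d.-1) * r^-1 ^+ d.-1.
  by rewrite exprVn mulfK // expf_neq0.
by rewrite rpredM // rpredX.
Qed.

End Dynamics.

(** * The Belyi polynomials *)

Lemma prod_sub_fact (k l : nat) : (l <= k)%N ->
  \prod_(j < k.+1 | j != l :> nat) (l%:R - j%:R)
    = (-1) ^+ (k - l) * ((k - l)`! * l`!)%:R :> algC.
Proof.
rewrite big_mkcond /=; elim: k => [|k IH].
  by rewrite leqn0 => /eqP->; rewrite big_ord1 /= !mul1r.
rewrite leq_eqVlt => /predU1P[->|]; last first.
  rewrite ltnS => lk; rewrite big_ord_recr /= IH // gtn_eqF //=.
  have e : (k - l).+1%:R = k.+1%:R - l%:R :> algC.
    by rewrite -subSn // natrB // leqW.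
  by rewrite subSn // exprS factS !natrM e; ring.
rewrite big_ord_recr /= eqxx subnn expr0 mulr1 mul1r fact0 mul1n.
have -> : (k.+1)`! = \prod_(j < k.+1) (k.+1 - j)%N.
  elim: (k.+1) => [|n IHn]; first by rewrite big_ord0.
  by rewrite factS big_ord_recl subn0 IHn.
rewrite natr_prod; apply: eq_bigr => j _.
by rewrite ltn_eqF //= natrB // ltnW.
Qed.

(** The value at 1 is the sum of the Lagrange basis polynomials for the nodes
0, ..., k, taken at d; that sum is the constant polynomial 1. *)
Lemma belyi_horner1 d k : (belyi d k).[1] = 1.
Proof.
pose w (i : 'I_k.+1) : algC := (-1) ^+ (k - i) / ((k - i)`! * i`!)%:R.
pose L := \sum_(i < k.+1) w i *: \prod_(j < k.+1 | j != i) ('X - j%:R%:P) - 1.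
have prodE x (i : 'I_k.+1) : (\prod_(j < k.+1 | j != i) ('X - j%:R%:P)).[x]
    = \prod_(j < k.+1 | j != i) (x - j%:R) :> algC.
  by rewrite horner_prod; apply: eq_bigr => j _; rewrite !hornerE.
have LE x : L.[x]
    = \sum_(i < k.+1) w i * \prod_(j < k.+1 | j != i) (x - j%:R) - 1.
  rewrite hornerD hornerN hornerC horner_sum; congr (_ - _).
  by apply: eq_bigr => i _; rewrite hornerZ prodE.
have L0 : L = 0.
  apply: (@roots_geq_poly_eq0 _ _ [seq n%:R | n <- iota 0 k.+1]).
  - apply/allP=> _ /mapP[l + ->]; rewrite mem_iota add0n ltnS => /andP[_ lk].
    have lk1 : (l < k.+1)%N by [].
    rewrite rootE LE (bigD1 (Ordinal lk1)) //= [X in _ + X - _]big1 => [|i il].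
      rewrite addr0 prod_sub_fact // /w /= mulrACA -expr2 sqrr_sign.
      rewrite mulVf ?mulr1 ?subrr //.
      by rewrite pnatr_eq0 -lt0n muln_gt0 !fact_gt0.
    rewrite (bigD1 (Ordinal lk1)) 1?eq_sym //=.
    by rewrite subrr mul0r mulr0.
  - by rewrite map_inj_uniq ?iota_uniq //; exact: (mulrIn (oner_neq0 _)).
  - rewrite size_map size_iota (leq_trans (size_polyD _ _)) // geq_max.
    rewrite size_polyN size_poly1 andbT; apply: (leq_trans (size_sum _ _ _)).
    apply/bigmax_leqP => i _; apply: (leq_trans (size_scale_leq _ _)).
    rewrite size_prod => [|j _]; last by rewrite polyXsubC_eq0.
    rewrite (eq_bigr (fun=> 2%N)) => [|j _]; last by rewrite size_XsubC.
    by rewrite sum_nat_const muln2 -addnn -addSn addnK cardC1 card_ord.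
have := LE d%:R; rewrite L0 horner0 => /esym/eqP.
rewrite subr_eq0 => /eqP {2}<-.
rewrite /belyi horner_sum; apply: eq_bigr => i _.
by rewrite hornerZ hornerXn expr1n mulr1.
Qed.

Lemma coef_belyi d k n : (k < d)%N -> (belyi d k)`_n =
  if (n <= d)%N && (d - n <= k)%N then
   (-1) ^+ (k - (d - n)) / ((k - (d - n))`! * (d - n)`!)%:R
       * \prod_(j < k.+1 | j != (d - n)%N :> nat) (d%:R - j%:R) else 0.
Proof.
move=> kd; rewrite /belyi coef_sum.
case: ifP => [/andP[nd dn]|h].
  rewrite (bigD1 (Ordinal (dn : (d - n < k.+1)%N))) //=.
  rewrite [X in _ + X]big1 => [|i ne].
    by rewrite coefZ coefXn subKn // eqxx mulr1 addr0.
  rewrite coefZ coefXn; case: eqP => [e|]; last by rewrite mulr0.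
  case/negP: ne; apply/eqP/val_inj => /=; rewrite e subKn //.
  by rewrite ltnW // (leq_trans (ltn_ord i)).
rewrite [LHS]big1 // => i _; rewrite coefZ coefXn.
case: eqP => [e|]; last by rewrite mulr0.
have id : (i <= d)%N by rewrite ltnW // (leq_trans (ltn_ord i)).
by move: h; rewrite e leq_subr subKn // -ltnS ltn_ord.
Qed.

Section BelyiValuation.

Variables (V : valring algC) (d k : nat).
Hypotheses (kd : (k < d)%N) (dV : d`!%:R^-1 \in V).

Lemma fact_dvd_inv n : (n %| d`!)%N -> n%:R^-1 \in V.
Proof.
move=> n_dvd; have n0 : (n%:R : algC) != 0.
  by rewrite pnatr_eq0 -lt0n (dvdn_gt0 (fact_gt0 d)).
have -> : n%:R^-1 = (d`! %/ n)%:R * d`!%:R^-1 :> algC.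
  rewrite -{2}(divnK n_dvd) natrM invfM mulrA mulfV ?mul1r //.
  by rewrite pnatr_eq0 -lt0n divn_gt0 ?(dvdn_leq (fact_gt0 d)) //
     (dvdn_gt0 (fact_gt0 d)).
by rewrite rpredM // rpred_nat.
Qed.

Lemma belyi_over : belyi d k \is a polyOver V.
Proof.
apply: rpred_sum => i _; apply: polyOverZ; last by rewrite rpredX ?polyOverX.
have ik : (i <= k)%N by rewrite -ltnS.
rewrite rpredM //; last first.
  by apply: rpred_prod => j _; rewrite rpredB // rpred_nat.
rewrite rpredM ?rpredX ?rpredN ?rpred1 // fact_dvd_inv //.
apply: (@dvdn_trans k`!).
  by rewrite -(bin_fact ik) [(i`! * _)%N]mulnC dvdn_mull.
by rewrite -(bin_fact (ltnW kd)) dvdn_mull // dvdn_mulr.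
Qed.

Lemma size_belyi : size (belyi d k) = d.+1.
Proof.
apply/eqP; rewrite eqn_leq; apply/andP; split.
  apply/leq_sizeP => j dj; rewrite coef_belyi //.
  by rewrite leqNgt dj.
rewrite ltnNge; apply/negP => /leq_sizeP/(_ d (leqnn d))/eqP.
rewrite coef_belyi // leqnn subnn /= subn0 fact0 muln1; apply/negP.
rewrite mulf_neq0 //.
  by rewrite mulf_neq0 ?signr_eq0 // invr_eq0 pnatr_eq0 -lt0n fact_gt0.
apply/prodf_neq0 => j _; rewrite subr_eq0 eqr_nat gtn_eqF //.
exact: leq_trans (ltn_ord j) kd.
Qed.

Lemma lead_belyi_inv : (lead_coef (belyi d k))^-1 \in V.
Proof.
rewrite lead_coefE size_belyi coef_belyi // leqnn subnn /= subn0.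
rewrite fact0 muln1 !invfM invrK invr_sign -prodfV.
rewrite rpredM ?rpredM ?rpredX ?rpredN ?rpred1 ?rpred_nat //.
apply: rpred_prod => j _; have jd : (j < d)%N := leq_trans (ltn_ord j) kd.
rewrite -natrB ?fact_dvd_inv ?dvdn_fact // ?subn_gt0 ?jd ?leq_subr //.
exact: ltnW.
Qed.

Lemma belyi_horner0 : (belyi d k).[0] = 0.
Proof. by rewrite horner_coef0 coef_belyi // subn0 (leqNgt d) kd andbF. Qed.

End BelyiValuation.

(** * Powers of a prime of a number field *)

(** The integers of K satisfy monic equations of bounded degree; this is where
the finiteness of K over Q enters the argument on powers of primes. *)
Lemma Qadj2_degree a b : exists e, forall x, Qadj2 a b x ->
  (size (minCpoly x) <= e.+1)%N.
Proof.
have [Qs [QsC [s1 es _]]] := num_field_exists [:: a; b].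
exists (\dim {:Qs}) => x.
pose S : {pred algC} := [pred x | `[< exists t, x = QsC t >]].
have Sdiv : GRing.divring_closed S.
  split; first by apply/asboolP; exists 1; rewrite rmorph1.
    move=> _ _ /asboolP[t ->] /asboolP[u ->]; apply/asboolP.
    by exists (t - u); rewrite rmorphB.
  move=> _ _ /asboolP[t ->] /asboolP[u ->]; apply/asboolP.
  by exists (t / u); rewrite fmorph_div.
have Smem y : y \in [:: a; b] -> y \in S.
  by rewrite -es => /mapP[t _ ->]; apply/asboolP; exists t.
move=> Kx; have /asboolP[t ->] : x \in S.
  by apply: Kx => //; apply: Smem; rewrite !inE eqxx ?orbT.
have [q eq] := polyOver1P (minPolyOver 1 t).
have [p0 [-> _] dvd] := minCpolyP (QsC t).
have q_root : root (map_poly ratr q) (QsC t).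
  have -> : map_poly ratr q = map_poly QsC (minPoly 1 t).
    rewrite eq -map_poly_comp; apply: eq_map_poly => c /=.
    by rewrite alg_num_field fmorph_rat.
  by rewrite fmorph_root root_minPoly.
rewrite dvd in q_root.
have sq : size q = (adjoin_degree 1 t).+1.
  by rewrite -size_minPoly eq size_map_poly.
rewrite size_map_poly (leq_trans (dvdp_leq _ q_root)) //.
  by rewrite -size_poly_eq0 sq.
by rewrite sq adjoin_degreeE dimv1 divn1 ltnS dimvS // subvf.
Qed.

Lemma minCpoly_coef0 x : x != 0 -> (minCpoly x)`_0 != 0.
Proof.
move=> x0; have [p0 [e p0_monic] dvd] := minCpolyP x.
rewrite e coef_map /= fmorph_eq0 -horner_coef0; apply/negP => p00.
have [q eq] : exists q, p0 = q * ('X - 0%:P) by apply/factor_theorem.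
have qroot : root (map_poly ratr q) x.
  have := root_minCpoly x; rewrite e eq rmorphM /= rootM subr0 map_polyX.
  by rewrite rootX (negPf x0) orbF.
rewrite dvd in qroot.
have q0 : q != 0.
  by apply: contraTneq p0_monic => q0; rewrite eq q0 mul0r monicE lead_coef0
    eq_sym oner_eq0.
have := dvdp_leq q0 qroot.
by rewrite eq size_Mmonic ?monicXsubC // size_XsubC addn2 ltnn.
Qed.

Section PrimeValuation.

Variables (V : valring algC) (p : nat).
Hypotheses (p_pr : prime p) (pV : p%:R \in valring_max V).

Let p0 : p%:R != 0 :> algC.
Proof. by rewrite pnatr_eq0 -lt0n prime_gt0. Qed.

Let piV : p%:R^-1 \notin V.
Proof. by move: pV; rewrite inE (negPf p0) /= => /andP[]. Qed.

Lemma prime_coprime_inv (z : int) : ~~ (p %| `|z|)%N ->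
  z%:~R != 0 :> algC /\ z%:~R^-1 \in V.
Proof.
move=> pz; split.
  by rewrite intr_eq0; apply: contraNneq pz => ->; rewrite absz0 dvdn0.
apply: (@valring_coprime_inv V z p) => //.
by rewrite coprimezE coprime_sym prime_coprime.
Qed.

Lemma int_dvd_or_inv c : c \in Num.int ->
  c / p%:R \in V \/ c != 0 /\ c^-1 \in V.
Proof.
move=> /intrP[z ->]; have [pz|pz] := boolP (p %| `|z|)%N.
  left; have /dvdzP[q ->] : (p %| z)%Z by [].
  by rewrite intrM mulfK // valring_int.
by right; exact: prime_coprime_inv.
Qed.

Lemma int_unbounded (z : int) : z != 0 ->
  exists n, z%:~R / p%:R ^+ n \notin V.
Proof.
move=> z0; have z_gt0 : (0 < `|z|)%N by rewrite absz_gt0.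
have [m pm] := pfactor_coprime p_pr z_gt0.
set l := logn p `|z| => em; exists l.+1.
have -> : z%:~R = (sgz z * m)%:~R * p%:R ^+ l :> algC.
  by rewrite {1}[z]intEsg em PoszM mulrA intrM -[in RHS]natrX.
have [m0 miV] : (sgz z * m)%:~R != 0 :> algC /\ (sgz z * m)%:~R^-1 \in V.
  apply: prime_coprime_inv.
  have -> : `|(sgz z * m)%R|%N = m.
    by rewrite abszM; case: sgzP z0; rewrite ?mul1n.
  by rewrite -prime_coprime.
move: (_%:~R) m0 miV => q q0 qiV; apply: contra piV => h.
have -> : p%:R^-1 = q^-1 * (q * p%:R ^+ l / p%:R ^+ l.+1) :> algC.
  by rewrite exprS; field; rewrite q0 p0 expf_neq0.
by rewrite rpredM.
Qed.

Lemma horner_rec_over x (s : seq algC) : x \in V ->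
  {subset s <= Num.int} -> horner_rec s x \in V.
Proof.
move=> xV; elim: s => [|c s IH] sZ /=; first exact: rpred0.
rewrite rpredD ?rpredM ?IH // => [y ys|]; first by rewrite sZ // inE ys orbT.
by have /intrP[z ->] := sZ c (mem_head _ _); exact: valring_int.
Qed.

(** Here s lists the coefficients of a polynomial, not all divisible by p, that
vanishes at x modulo p up to the factor x^m.  A lowest coefficient divisible by
p can be dropped; once it is a unit, the whole value of the polynomial is a unit,
because x is in the maximal ideal. *)
Lemma expr_divp_root x (s : seq algC) m : x \in valring_max V ->
  {subset s <= Num.int} -> ~~ all (fun c => c / p%:R \in V) s ->
  x ^+ m * horner_rec s x / p%:R \in V ->
  x ^+ (m + (size s).-1) / p%:R \in V.
Proof.
move=> xm; have xV := valring_max_sub xm.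
elim: s m => [|c s IH] m //= sZ; rewrite negb_and.
have sZ' : {subset s <= Num.int} by move=> y ys; rewrite sZ // inE ys orbT.
have hV := horner_rec_over xV sZ'.
have [cp|[c0 ciV]] := int_dvd_or_inv (sZ c (mem_head _ _)).
  rewrite cp /= => sp h; have s_gt0 : (0 < size s)%N by case: (s) sp.
  rewrite -(prednK s_gt0) addnS -addSn IH //.
  have -> : x ^+ m.+1 * horner_rec s x / p%:R
      = x ^+ m * (horner_rec s x * x + c) / p%:R - x ^+ m * (c / p%:R).
    by rewrite exprS; field.
  by rewrite rpredB // rpredM // rpredX.
move=> _ h; have cV : c \in V.
  by have /intrP[z ->] := sZ c (mem_head _ _); exact: valring_int.
have uV : (c + x * horner_rec s x)^-1 \in V.
  by rewrite valring_unit_addr // valring_maxMr.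
set u := c + _ in uV; have u0 : u != 0.
  apply: contraNneq (valring_max_neq1 V) => u0.
  have -> : 1 = x * (- horner_rec s x / c).
    have e : x * horner_rec s x = - c.
      by apply/eqP; rewrite -addr_eq0 addrC -/u u0.
    by rewrite mulrA mulrN e opprK mulfV.
  by rewrite valring_maxMr // rpredM // rpredN.
have -> : x ^+ (m + size s) / p%:R
    = x ^+ size s * (x ^+ m * (horner_rec s x * x + c) / p%:R * u^-1).
  have -> : horner_rec s x * x + c = u by rewrite /u addrC mulrC.
  by rewrite exprD; field; rewrite u0 p0.
by rewrite rpredM ?rpredX // rpredM.
Qed.

Lemma Aint_coef_int x : x \in Aint -> {subset (minCpoly x : seq _) <= Num.int}.
Proof. by move=> xZ c /(nthP 0)[i _ <-]; exact: (polyOverP xZ). Qed.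

Lemma Aint_expr_divp e x : x \in Aint -> (size (minCpoly x) <= e.+1)%N ->
  x \in valring_max V -> x ^+ e / p%:R \in V.
Proof.
move=> xZ sz xm.
have lt1 := size_minCpoly x.
have le : ((size (minCpoly x)).-1 <= e)%N.
  by rewrite -ltnS prednK // (ltn_trans _ lt1).
rewrite -(subnK le) exprD -mulrA.
apply: rpredM; first exact: rpredX (valring_max_sub xm).
apply: (@expr_divp_root x (minCpoly x) 0 xm (Aint_coef_int xZ)).
  apply/allPn; exists (lead_coef (minCpoly x)).
    by rewrite lead_coefE mem_nth // prednK // (ltn_trans _ lt1).
  by rewrite (monicP (minCpoly_monic x)) div1r.
have := root_minCpoly x; rewrite rootE /horner => /eqP->.
by rewrite mulr0 mul0r rpred0.
Qed.

(** The bound |x|^e <= |t| is stable under addition by the ultrametric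
inequality. *)
Lemma exprD_over e (t x y : algC) :
  x ^+ e / t \in V -> y ^+ e / t \in V -> (x + y) ^+ e / t \in V.
Proof.
have wl u v : u != 0 -> v / u \in V -> u ^+ e / t \in V ->
    (u + v) ^+ e / t \in V.
  move=> u0 vu ut; have -> : u + v = u * (1 + v / u).
    by rewrite mulrDr mulr1 mulrCA mulfV ?mulr1.
  by rewrite exprMn mulrAC rpredM // rpredX // rpredD // rpred1.
have [->|x0] := eqVneq x 0; first by rewrite add0r.
have [->|y0] := eqVneq y 0; first by rewrite addr0.
move=> xt yt; have /orP[h|] := valring_total V (y / x); first exact: wl.
by rewrite invf_div => h; rewrite addrC wl.
Qed.

Lemma ideal_exp_over (O P : algC -> Prop) e n w : (0 < e)%N ->
  (forall x, O x -> x \in V) ->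
  (forall x, P x -> x ^+ e / p%:R \in V) ->
  ideal_exp O P n w -> w ^+ e / p%:R ^+ n \in V.
Proof.
move=> e_gt0 OV PV; elim: n w => [|n IH] w /=.
  by move=> Ow; rewrite expr0 divr1 rpredX // OV.
case=> s sP ->; rewrite big_seq; elim/big_ind: _.
- by rewrite expr0n eqn0Ngt e_gt0 mul0r rpred0.
- by move=> x y; exact: exprD_over.
move=> u /sP[Pu /IH uV].
have -> : (u.1 * u.2) ^+ e / p%:R ^+ n.+1
    = (u.1 ^+ e / p%:R) * (u.2 ^+ e / p%:R ^+ n).
  by rewrite exprMn exprS invfM; ring.
by rewrite rpredM // PV.
Qed.

(** The nonzero constant coefficient of the minimal polynomial is a multiple of
y in V. *)
Lemma Aint_unbounded y e : y \in Aint -> y \in V -> y != 0 ->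
  exists n, y ^+ e / p%:R ^+ n \notin V.
Proof.
move=> yZ yV y0; have c0 := minCpoly_coef0 y0.
have sZ := Aint_coef_int yZ; have := root_minCpoly y.
rewrite rootE /horner; case: (minCpoly y : seq _) c0 sZ => [|c s] /=.
  by rewrite eqxx.
move=> c0 sZ /eqP hy.
have hV : horner_rec s y \in V.
  by apply: horner_rec_over => // z zs; rewrite sZ // inE zs orbT.
have /intrP[z ez] := sZ c (mem_head _ _).
have z0 : z ^+ e != 0 by rewrite expf_neq0 // -(intr_eq0 algC) -ez.
have [n zn] := int_unbounded z0; exists n; apply: contra zn => yn.
have -> : (z ^+ e)%:~R = y ^+ e * (- horner_rec s y) ^+ e :> algC.
  rewrite rmorphXn /= -ez -exprMn; congr (_ ^+ e).
  by apply/eqP; rewrite mulrN -addr_eq0 addrC mulrC hy.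
by rewrite mulrAC rpredM // rpredX // rpredN.
Qed.

End PrimeValuation.

(** * Orders at a prime of Q(a, b) *)

Section PrimeIdeal.

Variables (a b : algC) (p : nat) (P : algC -> Prop).

Let K := Qadj2 a b.
Let O := ring_of_integers K.

Hypotheses (p_pr : prime p) (P_above : prime_ideal_above K p P).

Lemma Qadj2_subring : subring K.
Proof.
split=> [|x y Kx Ky|x y Kx Ky] S Sdiv aS bS.
- by case: Sdiv.
- by case: (Sdiv) => _ SB _; apply: SB; [exact: Kx | exact: Ky].
- case: (Sdiv) => S1 _ SD; have -> : x * y = x / (1 / y) by rewrite div1r invrK.
  by apply: (SD) (SD _ _ S1 _); [exact: Kx | exact: Ky].
Qed.

Lemma ring_of_integers_subring : subring O.
Proof.
case: Qadj2_subring => K1 KB KM.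
split=> [|x y [Kx xZ] [Ky yZ]|x y [Kx xZ] [Ky yZ]].
- by split; rewrite ?Aint1.
- by split; [exact: KB | rewrite rpredB].
- by split; [exact: KM | rewrite rpredM].
Qed.

Lemma Qadj2_int z : K z%:~R.
Proof.
move=> S Sdiv _ _; have [S1 SB _] := Sdiv.
have S0 : 0 \in S by rewrite -(subrr 1) SB.
have SN x : x \in S -> - x \in S by move=> Sx; rewrite -sub0r SB.
have Snat n : n%:R \in S.
  by elim: n => // n IH; rewrite mulrS -[1 *+ n]opprK SB ?SN.
case: z => n; first exact: Snat.
by rewrite NegzE mulrNz; apply: SN; exact: Snat.
Qed.

Lemma ring_of_integers_int z : O z%:~R.
Proof. by split; [exact: Qadj2_int | exact: Aint_int]. Qed.

Lemma prime_above_int z : coprime `|z| p -> ~ P z%:~R.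
Proof.
move=> cop Pz; case: P_above => [[[_ _ PD PM] P1 _] Pp]; apply: P1.
have [|u [v <-]] := @intr_coprimez z p; first by rewrite coprimezE.
by apply: PD; apply: PM => //; exact: ring_of_integers_int.
Qed.

(** The first power of P in the sense of sums of products is P itself. *)
Lemma ideal_ord0 x : O x -> ~ P x -> ideal_ord O P x 0.
Proof.
move=> Ox Px; split=> // -[s sP ex]; apply: Px; rewrite ex big_seq.
case: P_above => [[[_ P0 PD PM] _ _] _]; elim/big_ind: _ => // u /sP[Pu Ou].
by rewrite mulrC; exact: PM.
Qed.

(** The powers of P have zero intersection: in a valuation ring dominating the
integers of K at P, an element of P^n has its e-th power divisible by p^n. *)
Lemma ideal_ord_exists y : O y -> y != 0 -> exists n, ideal_ord O P y n.
Proof.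
move=> Oy y0; case: P_above => [[[PO P0 PD PM] P1 _] Pp].
have [|V [OV PV]] := valring_dominating ring_of_integers_subring PO.
  move=> I1; apply: P1; elim: I1 => // s c x Ps Oc _ Px.
  by apply: PD => //; rewrite mulrC; exact: PM.
have [e deg] := Qadj2_degree a b.
have e_gt0 : (0 < e)%N.
  rewrite -ltnS (leq_trans (size_minCpoly 1)) // deg //.
  by case: Qadj2_subring.
have PV' x : P x -> x ^+ e / p%:R \in V.
  move=> Px; have [Kx xZ] := PO x Px.
  by apply: Aint_expr_divp => //; [exact: PV | exact: deg | exact: PV].
have [n yn] := Aint_unbounded p_pr (PV _ Pp) e Oy.2 (OV _ Oy) y0.
have {yn} : ~ ideal_exp O P n y.
  by move=> /(ideal_exp_over e_gt0 OV PV') h; rewrite h in yn.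
elim: n => [|n IH] yn; first by case: yn.
by have [h|/IH] := pselect (ideal_exp O P n y); first by exists n.
Qed.

End PrimeIdeal.

(** * Periodic critical points of the Belyi family *)

Lemma belyi_family_valring (V : valring algC) d k a c :
  (3 <= d)%N -> (1 <= k <= d - 2)%N -> d`!%:R^-1 \in V ->
  pcf_periodic (belyi_family d k a c) -> [/\ a \in V, a^-1 \in V & c \in V].
Proof.
move=> d_ge3 /andP[_ k_le] dV [[n0 n0_gt0 per0] [n1 n1_gt0 per1]].
have kd : (k < d)%N.
  by rewrite (leq_ltn_trans k_le) // ltn_subrL (ltn_trans _ d_ge3).
apply: (@valring_periodic _ V (belyi d k) a c d _ _ _ _ _ _ n0 n1) => //.
- exact: belyi_over.
- exact: size_belyi.
- exact: ltnW.
- exact: lead_belyi_inv.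
- exact: belyi_horner0.
- exact: belyi_horner1.
Qed.

(** For a = 0 the map is constant, and its only periodic point is its value. *)
Lemma belyi_family_neq0 d k a c :
  pcf_periodic (belyi_family d k a c) -> a != 0.
Proof.
move=> [[[//|n0] _ per0] [[//|n1] _ per1]]; apply/eqP=> a0.
move: per0 per1; rewrite !iterS /belyi_family a0 scale0r add0r !hornerC => ->.
by move/eqP; rewrite eq_sym oner_eq0.
Qed.

Theorem proposition2 :
  exists E : seq (nat * nat),
  forall d k : nat, (3 <= d)%N -> (1 <= k <= d - 2)%N -> (d, k) \notin E ->
  exists2 p : nat, prime p &
  forall alpha beta : algC,
    pcf_periodic (belyi_family d k alpha beta) ->
  forall P : algC -> Prop, prime_ideal_above (Qadj2 alpha beta) p P ->
    adic_val (Qadj2 alpha beta) P alpha 0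
    /\ adic_val_ge0 (Qadj2 alpha beta) P beta.
Proof.
exists [::] => d k d_ge3 k_bd _; have [p p_gt p_pr] := prime_above d`!.
(* p > d! makes p prime to d! *)
exists p => // a b per P P_above.
have m_gt0 := fact_gt0 d; set m := d`! in p_gt m_gt0.
have m0 N : m%:R ^+ N != 0 :> algC.
  by rewrite expf_neq0 // pnatr_eq0 -lt0n.
have copm N : coprime (m ^ N) p.
  by rewrite coprimeXl // coprime_sym prime_coprime // gtnNdvd.
have val (V : valring algC) (mV : m%:R^-1 \in V) :=
  belyi_family_valring d_ge3 k_bd mV per.
have a0 := belyi_family_neq0 per.
have [|N1 aZ] := @Aint_valrings m a m_gt0; first by move=> V /val[].
have [|N2 aiZ] := @Aint_valrings m a^-1 m_gt0; first by move=> V /val[].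
have [|N3 bZ] := @Aint_valrings m b m_gt0; first by move=> V /val[].
have [_ _ KM] := Qadj2_subring a b.
have Om N : ring_of_integers (Qadj2 a b) (m%:R ^+ N).
  by rewrite -natrX; exact: (ring_of_integers_int a b (m ^ N)%N).
have Pm N : ~ P (m%:R ^+ N).
  by rewrite -natrX; exact: (prime_above_int P_above (z := (m ^ N)%N) (copm N)).
have Ka : Qadj2 a b a by [].
have Kb : Qadj2 a b b by [].
have Kai : Qadj2 a b a^-1.
  by move=> S [S1 SB SD] aS bS; rewrite -[a^-1]mul1r; exact: SD.
have Oa : ring_of_integers (Qadj2 a b) (m%:R ^+ N1 * a).
  by split=> //; apply: KM => //; case: (Om N1).
have Oai : ring_of_integers (Qadj2 a b) (m%:R ^+ N2 * a^-1).
  by split=> //; apply: KM => //; case: (Om N2).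
have Ob : ring_of_integers (Qadj2 a b) (m%:R ^+ N3 * b).
  by split=> //; apply: KM => //; case: (Om N3).
split.
  exists (m%:R ^+ N1 * a), (m%:R ^+ N1), 0%N, 0%N; split=> //.
  - by rewrite mulrAC mulfV ?mul1r.
  (* a and 1/a are both integral up to powers of m, and m is not in P *)
  - apply: (ideal_ord0 P_above) => // Pa; apply: (Pm (N1 + N2)%N).
    have -> : m%:R ^+ (N1 + N2) = (m%:R ^+ N2 * a^-1) * (m%:R ^+ N1 * a).
      by rewrite exprD; field.
    by case: P_above => [[[_ _ _ PM] _ _] _]; exact: PM.
  - exact: (ideal_ord0 P_above).
have [->|b0] := eqVneq b 0; [by left | right].
have [n ordb] := ideal_ord_exists p_pr P_above Ob (mulf_neq0 (m0 N3) b0).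
exists n%:Z => //; exists (m%:R ^+ N3 * b), (m%:R ^+ N3), n, 0%N; split=> //.
- by rewrite mulrAC mulfV ?mul1r.
- exact: (ideal_ord0 P_above).
- by rewrite subr0.
Qed.
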